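(* Let $\Pi$ be a blockchain protocol that satisfies $(t,\delta)$-weak fairness, $\delta\in[0,1)$. Suppose in addition that for every PPT adversary $\mathcal A$ controlling a set $T$ of at most $t$ participants, every $r$-admissible environment $\mathcal Z$ and every $j$ with $P_j\in S\setminus T$, it holds that $R^j_S(\mathcal E'_{\mathcal Z,\mathcal A})>0$ with overwhelming probability in the security parameter $\kappa$. Then following $\Pi$ is a $(t,0,\delta)$-EVP according to the utility function relative rewards, $U^j_T(\mathcal E)=R^j_T(\mathcal E)/R^j_S(\mathcal E)$ if $R^j_S(\mathcal E)\neq 0$ and $U^j_T(\mathcal E)=0$ otherwise.
   Context: Execution model. $\kappa$ is the security parameter. A protocol $\Pi$ is run by participants $S=\{P_1,\dots,P_n\}$ in the presence of an environment $\mathcal Z$ and an adversary $\mathcal A$ (all PPT interactive machines), in synchronous rounds. There are oracles $O_1,\dots,O_l$; each participant may ask $O_k$ at most $q_k$ queries per round, each at cost $c_k$. Messages are sent through a Diffuse functionality: the adversary sees the honest participants' messages of a round and may deliver its own first, but by the end of the round all honest participants receive all messages sent by honest participants. An environment is $r$-admissible if it is PPT, gets input $1^{p'(\kappa)}$, $p'$ a polynomial, and runs the protocol for $r=\pi(\kappa)\ne 0$ rounds, $\pi$ a polynomial, after which it terminates the execution. Adversaries are static: $\mathcal A$ controls from the beginning a set $T\subseteq S$ of participants; participants in $S\setminus T$ follow $\Pi$ (are honest). $H_T$ is the adversary that controls $T$ and follows $\Pi$, except that it delivers its messages first when multiple competing messages are produced in a round. Honest participants and $H_T$ ask all their available queries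 in each round. $\mathcal E_{\mathcal Z,\mathcal A}$ is the random execution with environment $\mathcal Z$ and adversary $\mathcal A$; $\mathcal E'_{\mathcal Z,\mathcal A}$ and $\mathcal E_{\mathcal Z,H_T}$ denote independent executions with the same $\mathcal Z$. Rewards and costs. $R^j_{V}(\mathcal E)\in\mathbb R$ is the (virtual) reward of a set $V\subseteq S$ of participants according to the local view of $P_j$ after the last complete round $r$ of $\mathcal E$; rewards of a set are obtained by summing individual rewards, so $R^j_S=R^j_T+R^j_{S\setminus T}$. $C_i(\mathcal E)=\sum_{k=1}^l c_k\, q_{i,k}(\mathcal E)$, where $q_{i,k}(\mathcal E)$ is the number of queries $P_i$ asked $O_k$ until the end of round $r$. The total cost $\sum_{i:P_i\in S}C_i(\mathcal E_{\mathcal Z,H_T})$ is nonzero. Weak fairness. $\Pi$ satisfies $(t,\delta)$-weak fairness, $\delta\in[0,1)$, if for every $r$-admissible environment $\mathcal Z$, every PPT adversary $\mathcal A$ controlling a set $T$ of at most $t$ participants, and every $j$ with $P_j\in S\setminus T$, with overwhelming probability in $\kappa$: (1) $R^j_{S\setminus T}(\mathcal E'_{\mathcal Z,\mathcal A})\ge(1-\delta)\dfrac{\sum_{i:P_i\in S\setminus T}C_i(\mathcal E_{\mathcal Z,H_T})}{\sum_{i:P_i\in S}C_i(\mathcal E_{\mathcal Z,H_T})}\,R^j_S(\mathcal E'_{\mathcal Z,\mathcal A})$; (2) for every subset $S_H\subseteq S$, $R^j_{S_H}(\mathcal E_{\mathcal Z,H_T})\ge(1-\delta)\dfrac{\sum_{i:P_i\in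 S_H}C_i(\mathcal E_{\mathcal Z,H_T})}{\sum_{i:P_i\in S}C_i(\mathcal E_{\mathcal Z,H_T})}\,R^j_S(\mathcal E_{\mathcal Z,H_T})$. EVP. Put $U^{\max}_T=\max_{P_j\in S\setminus T}U^j_T$ and $U^{\min}_T=\min_{P_j\in S\setminus T}U^j_T$. The protocol is a $(t,\epsilon,\epsilon')$-equilibrium with virtual payoffs (EVP) according to $\{U^j_T\}$ if for every PPT static adversary $\mathcal A$ controlling a set $T$ of at most $t$ participants and every $r$-admissible environment $\mathcal Z$, $$U^{\max}_T(\mathcal E'_{\mathcal Z,\mathcal A})\le U^{\min}_T(\mathcal E_{\mathcal Z,H_T})+\epsilon\,|U^{\min}_T(\mathcal E_{\mathcal Z,H_T})|+\epsilon'$$ with overwhelming probability in $\kappa$ (except with probability negligible in $\kappa$). *)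

(* Defs.v *)
From HB Require Import structures.
From mathcomp Require Import all_boot all_order all_algebra.
From mathcomp Require Import reals.

Set Implicit Arguments.
Unset Strict Implicit.
Unset Printing Implicit Defensive.

Import Order.TTheory GRing.Theory Num.Theory.
Local Open Scope ring_scope.

Notation bits := (seq bool).

(* A randomized computation returning an [A]: a tree that branches on fair coin
   tosses and on the answers to queries [Ask k x]; [k : L] says which query is
   meant and [x] is its argument.  With [L = void] only coins remain, so
   [computation void A] is a probability distribution on [A]. *)
Inductive computation (L A : Type) : Type :=
| Ret of A
| Flip of (bool -> computation L A)
| Ask of L & bits & (bits -> computation L A).
Arguments Ret {L A}.
Arguments Flip {L A}.
Arguments Ask {L A}.

Fixpoint bind L A B (d : computation L A) (f : A -> computation L B) :
    computation L B :=
  match d with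
  | Ret a => f a
  | Flip g => Flip (fun b => bind (g b) f)
  | Ask k x g => Ask k x (fun y => bind (g y) f)
  end.

Fixpoint foldM L A X (f : A -> X -> computation L A) (a : A) (s : seq X) :
    computation L A :=
  if s is x :: s' then bind (f a x) (fun a' => foldM f a' s') else Ret a.

Fixpoint relabel L L' A (h : L -> L') (d : computation L A) :
    computation L' A :=
  match d with
  | Ret a => Ret a
  | Flip g => Flip (fun b => relabel h (g b))
  | Ask k x g => Ask (h k) x (fun y => relabel h (g y))
  end.

Fixpoint Pr (R : realType) A (d : computation void A) (E : pred A) : R :=
  match d with
  | Ret a => (E a)%:R
  | Flip g => (Pr R (g true) E + Pr R (g false) E) / 2
  | Ask k _ _ => match k with end
  end.

Definition independent A B (d : computation void A) (e : computation void B) :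
    computation void (A * B) :=
  bind d (fun a => bind e (fun b => Ret (a, b))).

Definition negligible (R : realType) (f : nat -> R) : Prop :=
  forall c : nat, exists N : nat,
  forall kappa : nat, (N < kappa)%N -> `|f kappa| < kappa%:R ^- c.

Definition overwhelming (R : realType) (p : nat -> R) : Prop :=
  negligible (fun kappa => 1 - p kappa).

Definition is_polynomial (f : nat -> nat) : Prop :=
  exists p : {poly rat}, forall k : nat, (f k)%:R = p.[k%:R].

(* [I] and [O] name the channels on which the machine receives and sends; each
   activation consumes and produces a list of strings per channel.  [minit u] is
   the state of the machine started on the unary input 1^u. *)
Record machine (L : Type) (I O : finType) := Machine {
  mstate : Type;
  minit : nat -> mstate;
  mact : mstate -> {ffun I -> seq bits} ->
         computation L (mstate * {ffun O -> seq bits})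
}.
Arguments minit {L I O} m _.
Arguments mact {L I O} m _ _.

(* Probabilistic oracle Turing machines, with four one-way infinite tapes. *)
Inductive symbol := Blank | Bit of bool | EndString | EndChannel.
Inductive direction := Left | Stay | Right.
Inductive tape_name := InputTape | OutputTape | WorkTape | QueryTape.

Record tape := Tape { cells : seq symbol; head_pos : nat }.
Definition tapes := tape_name -> tape.

Definition tape_of (s : seq symbol) : tape := Tape s 0.

Definition scan (t : tape) : symbol := nth Blank (cells t) (head_pos t).

Definition write_move (t : tape) (wd : symbol * direction) : tape :=
  Tape (set_nth Blank (cells t) (head_pos t) wd.1)
       (match wd.2 with
        | Left => (head_pos t).-1
        | Stay => head_pos t
        | Right => (head_pos t).+1
        end).

Definition set_tape (c : tapes) (m : tape_name) (t : tape) : tapes :=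
  fun m' => match m, m' with
            | InputTape, InputTape | OutputTape, OutputTape
            | WorkTape, WorkTape | QueryTape, QueryTape => t
            | _, _ => c m'
            end.

(* The instruction attached to a control state.  [Query k q] sends the bit string
   at the beginning of the query tape, replaces that tape by the answer and goes
   to [q]. *)
Inductive instruction (L Q : Type) :=
| Halt
| Toss of (bool -> Q)
| Query of L & Q
| Step of ((tape_name -> symbol) -> Q * (tape_name -> symbol * direction)).

Record turing_machine (L : Type) := TuringMachine {
  control : finType;
  start : control;
  program : control -> instruction L control
}.

Fixpoint leading_bits (s : seq symbol) : bits :=
  if s is Bit b :: s' then b :: leading_bits s' else [::].

Fixpoint written (s : seq symbol) : seq symbol :=
  match s with
  | [::] | Blank :: _ => [::]
  | a :: s' => a :: written s'
  end.

(* [None] when the machine has not halted within [fuel] instructions. *)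
Fixpoint run L (M : turing_machine L) (fuel : nat) (q : control M) (c : tapes) :
    computation L (option tapes) :=
  match program q with
  | Halt => Ret (Some c)
  | i =>
    if fuel is fuel'.+1 then
      match i with
      | Halt => Ret (Some c)
      | Toss f => Flip (fun b => run fuel' (f b) c)
      | Query k q' =>
          Ask k (leading_bits (cells (c QueryTape)))
            (fun y => run fuel' q'
                        (set_tape c QueryTape (tape_of (map Bit y))))
      | Step f =>
          let: (q', w) := f (fun m => scan (c m)) in
          run fuel' q' (fun m => write_move (c m) (w m))
      end
    else Ret None
  end.

Definition encode (C : finType) (x : {ffun C -> seq bits}) : seq symbol :=
  flatten
    [seq rcons (flatten [seq rcons (map Bit w) EndString | w <- x c]) EndChannel
    | c <- enum C].

Definition initial_tapes (u : nat) : tapes :=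
  set_tape (fun=> tape_of [::]) WorkTape (tape_of (nseq u (Bit true))).

Definition load (C : finType) (x : {ffun C -> seq bits}) (c : tapes) : tapes :=
  fun m => match m with
           | InputTape => tape_of (encode x)
           | WorkTape => c WorkTape
           | OutputTape | QueryTape => tape_of [::]
           end.

Inductive computation_rel L A B (r : A -> B -> Prop) :
    computation L A -> computation L B -> Prop :=
| RelRet a b of r a b : computation_rel r (Ret a) (Ret b)
| RelFlip f g of (forall b, computation_rel r (f b) (g b)) :
    computation_rel r (Flip f) (Flip g)
| RelAsk k x f g of (forall y, computation_rel r (f y) (g y)) :
    computation_rel r (Ask k x f) (Ask k x g).

(* [M] is realized by a Turing machine, restarted at each activation with its work
   tape kept.  For a polynomial [p], whatever the machine receives, the activation
   number [a] halts within [p] of the length of everything received so far, namely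
   the initial input 1^u and inputs of total length [N + size (encode x)], plus
   [a]; the part of an oracle answer beyond the time bound goes unread.  What it
   sends has length at most [p (u + a)], independently of what it has received:
   otherwise machines exchanging messages of doubling length for polynomially many
   rounds would count as polynomial-time. *)
Definition PPT L (I O : finType) (M : machine L I O) : Prop :=
  exists (T : turing_machine L) (p : nat -> nat)
         (sim : nat -> nat -> nat -> mstate M -> tapes -> Prop),
  [/\ is_polynomial p,
      forall u, sim u 0%N 0%N (minit M u) (initial_tapes u) &
      forall u a N s c (x : {ffun I -> seq bits}), sim u a N s c ->
        let N' := (N + size (encode x))%N in
        computation_rel
          (fun (so : mstate M * {ffun O -> seq bits}) (h : option tapes) =>
             exists c', [/\ h = Some c',
               written (cells (c' OutputTape)) = encode so.2,
               (size (encode so.2) <= p (u + a))%N &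
               sim u a.+1 N' so.1 c'])
          (mact M s x) (run (p (u + a + N')%N) (start T) (load x c))].

(* Every run of the computation makes at least [b k] queries to each oracle [k]. *)
Fixpoint asks_all l A (d : computation 'I_l A) (b : 'I_l -> nat) : Prop :=
  match d with
  | Ret _ => forall k, b k = 0%N
  | Flip g => forall x, asks_all (g x) b
  | Ask k _ g =>
      forall y, asks_all (g y) (fun k' => if k' == k then (b k).-1 else b k')
  end.

(* The two channels of a participant. *)
Notation env_channel := false.
Notation net_channel := true.

Inductive event (l : nat) :=
| Coin of bool
| Answer of 'I_l & bits & bits.

(* What a participant sees in one round: its input from the environment, its coins
   and its queries with their answers, and the messages delivered to it by the end
   of the round. *)
Record round_view (l : nat) := RoundView {
  rv_input : seq bits;
  rv_events : seq (event l);
  rv_received : seq bits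
}.

(* The security parameter and the rounds completed so far. *)
Definition view (l : nat) : Type := nat * seq (round_view l).

(* A protocol for participants ['I_n] and oracles ['I_l].  The oracles are run by
   one stateful randomized functionality that is told who asks; [quota] is q_k and
   [price] is c_k; [reward j v i] is the reward of participant [i] according to the
   local view [v] of [j]. *)
Record protocol (R : realType) (n l : nat) := Protocol {
  ostate : Type;
  oinit : nat -> ostate;
  oask : ostate -> 'I_l -> 'I_n -> bits -> computation void (ostate * bits);
  quota : 'I_l -> nat;
  price : 'I_l -> R;
  participant : 'I_n -> machine 'I_l bool bool;
  participant_PPT : forall i, PPT (participant i);
  participant_asks_all :
    forall i s x, asks_all (mact (participant i) s x) quota;
  reward : 'I_n -> view l -> 'I_n -> R
}.

(* The environment talks to the participants ([Some i]) and to the adversary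
   ([None]).  It gets 1^(env_input kappa) and runs env_rounds kappa rounds. *)
Record environment (n : nat) := Environment {
  env_machine : machine void (option 'I_n) (option 'I_n);
  env_input : nat -> nat;
  env_rounds : nat -> nat
}.

Definition admissible n (Z : environment n) : Prop :=
  [/\ PPT (env_machine Z),
      is_polynomial (env_input Z), is_polynomial (env_rounds Z) &
      forall kappa, env_rounds Z kappa != 0%N].

(* Channels of an adversary controlling [T]:
   - [inl None]: the environment;
   - [inl (Some i)], [i] in [T]: the communication of participant [i] with the
     environment;
   - [inr i], [i] not in [T]: on input, the messages that the honest participant
     [i] diffuses in this round; on output, the sequence of messages that the
     adversary has delivered to [i].
   A query [(i, k)] is a query of the controlled participant [i] to oracle [k]. *)
Definition adversary (n l : nat) : Type :=
  machine ('I_n * 'I_l) (option 'I_n + 'I_n)%type (option 'I_n + 'I_n)%type.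

(* The adversary orders the messages [d] it wants delivered as it likes; the honest
   messages that it left out are delivered afterwards, in the same round. *)
Definition diffuse (d honest : seq bits) : seq bits :=
  d ++ [seq m <- honest | m \notin d].

Definition party_input (env net : seq bits) : {ffun bool -> seq bits} :=
  [ffun c => if c == env_channel then env else net].

Section Execution.

Context {R : realType} {n l : nat} (Pi : protocol R n l).

Definition participant_states : Type := forall i, mstate (participant Pi i).

(* Answers the queries of a computation run on behalf of the participants in [V];
   [m] counts the queries made in the current round, [w] logs the events.  A query
   above the quota, or on behalf of somebody else, is not asked. *)
Fixpoint serve (V : {set 'I_n}) A (d : computation ('I_n * 'I_l) A)
    (m : 'I_n -> 'I_l -> nat) (o : ostate Pi) (w : seq (event l)) :
    computation void (A * ('I_n -> 'I_l -> nat) * ostate Pi * seq (event l)) :=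
  match d with
  | Ret a => Ret (a, m, o, w)
  | Flip g => Flip (fun b => serve V (g b) m o (rcons w (Coin l b)))
  | Ask (i, k) x g =>
      if (i \in V) && (m i k < quota Pi k)%N then
        bind (oask o k i x) (fun oy =>
          serve V (g oy.2)
            (fun i' k' => (m i' k' + ((i' == i) && (k' == k)))%N)
            oy.1 (rcons w (Answer k x oy.2)))
      else serve V (g [::]) m o w
  end.

(* [H_T]: runs the participants in [T] as prescribed, and has their messages
   delivered to everybody before the honest ones.  Its state contains the messages
   delivered in the previous round. *)
Definition honest_adversary (T : {set 'I_n}) : adversary n l :=
  @Machine ('I_n * 'I_l) (option 'I_n + 'I_n)%type (option 'I_n + 'I_n)%type
    (participant_states * seq bits)
    (fun u => (fun i => minit (participant Pi i) u, [::]))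
    (fun s x =>
      bind
        (foldM
          (fun (py : participant_states * ('I_n -> {ffun bool -> seq bits})) i =>
            bind (relabel (fun k => (i, k))
                   (mact (participant Pi i) (py.1 i)
                      (party_input (x (inl (Some i))) s.2)))
              (fun so => Ret (dfwith py.1 so.1,
                              fun i' => if i' == i then so.2 else py.2 i')))
          (s.1, fun=> [ffun=> [::]]) (enum T))
        (fun py =>
          let own := flatten [seq py.2 i net_channel | i <- enum T] in
          let hon := flatten [seq x (inr i) | i <- enum (~: T)] in
          Ret ((py.1, diffuse own hon),
               [ffun c => match c with
                          | inl None => [::]
                          | inl (Some i) => py.2 i env_channel
                          | inr _ => own
                          end]))).

Section Rounds.

Context (Z : environment n) (T : {set 'I_n}) (A : adversary n l).

Record configuration := Configuration {
  c_env : mstate (env_machine Z);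
  c_adv : mstate A;
  c_parts : participant_states;
  c_oracle : ostate Pi;
  c_to_env : {ffun option 'I_n -> seq bits};
  c_views : 'I_n -> view l;
  c_queries : 'I_n -> 'I_l -> nat
}.

Definition initial_configuration (kappa : nat) : configuration :=
  {| c_env := minit (env_machine Z) (env_input Z kappa);
     c_adv := minit A kappa;
     c_parts := fun i => minit (participant Pi i) kappa;
     c_oracle := oinit Pi kappa;
     c_to_env := [ffun=> [::]];
     c_views := fun=> (kappa, [::]);
     c_queries := fun _ _ => 0%N |}.

Definition last_received (v : view l) : seq bits :=
  last [::] [seq rv_received r | r <- v.2].

Record honest_phase := HonestPhase {
  h_parts : participant_states;
  h_oracle : ostate Pi;
  h_queries : 'I_n -> 'I_l -> nat;
  h_out : 'I_n -> {ffun bool -> seq bits};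
  h_events : 'I_n -> seq (event l)
}.

Definition honest_turn (inp recv : 'I_n -> seq bits) (h : honest_phase)
    (i : 'I_n) : computation void honest_phase :=
  bind
    (serve [set i]
       (relabel (fun k => (i, k))
          (mact (participant Pi i) (h_parts h i) (party_input (inp i) (recv i))))
       (h_queries h) (h_oracle h) [::])
    (fun '(so, m, o, w) =>
       Ret {| h_parts := dfwith (h_parts h) so.1;
              h_oracle := o;
              h_queries := m;
              h_out := fun i' => if i' == i then so.2 else h_out h i';
              h_events := fun i' => if i' == i then w else h_events h i' |}).

(* One synchronous round: the environment hands out the inputs, the honest
   participants act, then the adversary acts having seen their messages, and all
   messages are delivered.  The entries of [c_parts] and [c_views] at members of
   [T] are meaningless. *)
Definition round (g : configuration) : computation void configuration :=
  bind (mact (env_machine Z) (c_env g) (c_to_env g)) (fun '(z, e) =>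
  bind (foldM
          (honest_turn (fun i => e (Some i))
                       (fun i => last_received (c_views g i)))
          {| h_parts := c_parts g;
             h_oracle := c_oracle g;
             h_queries := fun _ _ => 0%N;
             h_out := fun=> [ffun=> [::]];
             h_events := fun=> [::] |}
          (enum (~: T))) (fun h =>
  let hon := flatten [seq h_out h i net_channel | i <- enum (~: T)] in
  let adv_in : {ffun option 'I_n + 'I_n -> seq bits} :=
    [ffun c => match c with
               | inl None => e None
               | inl (Some i) => if i \in T then e (Some i) else [::]
               | inr i => if i \in T then [::] else h_out h i net_channel
               end] in
  bind (serve T (mact A (c_adv g) adv_in) (h_queries h) (h_oracle h) [::])
    (fun '(a, d, m, o, _) =>
  Ret {| c_env := z;
         c_adv := a;
         c_parts := h_parts h;
         c_oracle := o;
         c_to_env :=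
           [ffun c => match c with
                      | None => d (inl None)
                      | Some i => if i \in T then d (inl (Some i))
                                  else h_out h i env_channel
                      end];
         c_views := fun i =>
           ((c_views g i).1,
            rcons (c_views g i).2
              (RoundView (e (Some i)) (h_events h i)
                         (diffuse (d (inr i)) hon)));
         c_queries := fun i k => (c_queries g i k + m i k)%N |}))).

End Rounds.

(* The part of a finished execution on which rewards and costs depend. *)
Record outcome := Outcome {
  views : 'I_n -> view l;
  queries : 'I_n -> 'I_l -> nat
}.

Definition execution (Z : environment n) (T : {set 'I_n}) (A : adversary n l)
    (kappa : nat) : computation void outcome :=
  bind (foldM (fun g (_ : nat) => round T g) (initial_configuration Z A kappa)
          (iota 0 (env_rounds Z kappa)))
    (fun g => Ret (Outcome (c_views g) (c_queries g))).

Definition cost (i : 'I_n) (E : outcome) : R :=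
  \sum_(k < l) price Pi k * (queries E i k)%:R.

Definition cost_of (V : {set 'I_n}) (E : outcome) : R := \sum_(i in V) cost i E.

Definition reward_of (j : 'I_n) (V : {set 'I_n}) (E : outcome) : R :=
  \sum_(i in V) reward Pi j (views E j) i.

Definition fair_share (delta : R) (j : 'I_n) (V : {set 'I_n})
    (E Ecost : outcome) : bool :=
  reward_of j V E >=
  (1 - delta) * (cost_of V Ecost / cost_of [set: 'I_n] Ecost)
    * reward_of j [set: 'I_n] E.

Definition weak_fairness (t : nat) (delta : R) : Prop :=
  forall (Z : environment n) (T : {set 'I_n}) (A : adversary n l) (j : 'I_n),
    admissible Z -> (#|T| <= t)%N -> PPT A -> j \notin T ->
    overwhelming (fun kappa =>
      Pr R (independent (execution Z T A kappa)
                        (execution Z T (honest_adversary T) kappa))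
        (fun '(E', E) =>
           fair_share delta j (~: T) E' E &&
           [forall SH : {set 'I_n}, fair_share delta j SH E E])).

Definition utility : Type := {set 'I_n} -> 'I_n -> outcome -> R.

(* The maximum and minimum over the participants outside [T], of which [j0] is
   one. *)
Definition Umax (U : utility) (T : {set 'I_n}) (j0 : 'I_n) (E : outcome) : R :=
  \big[Num.max/U T j0 E]_(j | j \notin T) U T j E.

Definition Umin (U : utility) (T : {set 'I_n}) (j0 : 'I_n) (E : outcome) : R :=
  \big[Num.min/U T j0 E]_(j | j \notin T) U T j E.

(* If all participants are controlled, the maximum and minimum do not exist and
   nothing is required. *)
Definition EVP (t : nat) (eps eps' : R) (U : utility) : Prop :=
  forall (Z : environment n) (T : {set 'I_n}) (A : adversary n l) (j0 : 'I_n),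
    admissible Z -> (#|T| <= t)%N -> PPT A -> j0 \notin T ->
    overwhelming (fun kappa =>
      Pr R (independent (execution Z T A kappa)
                        (execution Z T (honest_adversary T) kappa))
        (fun '(E', E) =>
           Umax U T j0 E' <=
           Umin U T j0 E + eps * `|Umin U T j0 E| + eps')).

Definition relative_rewards : utility := fun T j E =>
  if reward_of j [set: 'I_n] E != 0
  then reward_of j T E / reward_of j [set: 'I_n] E
  else 0.

End Execution.

(* Main.v *)
Require Import Defs.
From mathcomp Require Import all_boot all_order all_algebra.
From mathcomp Require Import reals.
From mathcomp Require Import lra.

Set Implicit Arguments.
Unset Strict Implicit.
Unset Printing Implicit Defensive.

Import Order.TTheory GRing.Theory Num.Theory.
Local Open Scope ring_scope.

(* The cost shares of the honest and of the corrupted participants add up to 1.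
   Hence part (1) of fairness bounds every adversarial relative reward of T above
   by 1 - (1 - delta) (1 - s), where s is the cost share of T, while part (2) for
   S_H = T bounds every relative reward of T in the honest execution below by
   (1 - delta) s.  The two bounds differ by exactly delta. *)

Section Probability.

Context {R : realType}.

Lemma Pr_le1 A (d : computation void A) (E : pred A) : Pr R d E <= 1.
Proof.
elim: d => [a|g IH|[]] /=; first by case: (E a).
by have := IH true; have := IH false; lra.
Qed.

Lemma Pr_mono A (d : computation void A) (E F : pred A) :
  (forall x, E x -> F x) -> Pr R d E <= Pr R d F.
Proof.
move=> EF; elim: d => [a|g IH|[]] /=.
  by rewrite ler_nat; case Ea: (E a) => //; rewrite EF.
by have := IH true; have := IH false; lra.
Qed.

Lemma Pr_predT A (d : computation void A) : Pr R d predT = 1.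
Proof. by elim: d => [a|g IH|[]] //=; rewrite !IH; lra. Qed.

(** This is the union bound for the complements, stated without negations. The inequality is affine
    in the three probabilities, so it passes from the leaves to averages over a coin. *)
Lemma Pr_predI_ge A (d : computation void A) (E F : pred A) :
  Pr R d E + Pr R d F - 1 <= Pr R d (predI E F).
Proof.
elim: d => [a|g IH|[]] /=; first by case: (E a); case: (F a) => /=; lra.
by have := IH true; have := IH false; lra.
Qed.

Lemma Pr_bind_Ret A B (d : computation void A) (f : A -> B) (E : pred B) :
  Pr R (bind d (fun a => Ret (f a))) E = Pr R d (fun a => E (f a)).
Proof. by elim: d => [a|g IH|[]] //=; rewrite !IH. Qed.

(** At each leaf of [d] the event no longer depends on [e], and averaging a constant over the
    finite-depth coin tree [e] returns that constant. *)
Lemma Pr_independent_fst A B (d : computation void A) (e : computation void B)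
    (E : pred A) :
  Pr R (independent d e) (fun x => E x.1) = Pr R d E.
Proof.
rewrite /independent; elim: d => [a|g IH|[]] /=; last by rewrite !IH.
rewrite Pr_bind_Ret /=; elim: e => [b|g IH|[]] //=; rewrite !IH; lra.
Qed.

Lemma Pr_independent_snd A B (d : computation void A) (e : computation void B)
    (E : pred B) :
  Pr R (independent d e) (fun x => E x.2) = Pr R e E.
Proof.
rewrite /independent; elim: d => [a|g IH|[]] /=; last by rewrite !IH; lra.
by rewrite Pr_bind_Ret.
Qed.

Lemma negligible_le (f g : nat -> R) :
  (forall k, 0 <= g k <= f k) -> negligible f -> negligible g.
Proof.
move=> gf fN c; have [N HN] := fN c; exists N => k /HN; apply: le_lt_trans.
by have /andP[g0 le_gf] := gf k; rewrite !ger0_norm // (le_trans g0).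
Qed.

Lemma negligible_add (f g : nat -> R) :
  negligible f -> negligible g -> negligible (fun k => f k + g k).
Proof.
move=> fN gN c; have [N HN] := fN c.+1; have [M HM] := gN c.+1.
(* Both functions are taken below [k ^- c.+1]; the entry 1 forces [k >= 2], so that twice this bound
   is at most [k ^- c]. *)
exists (maxn 1 (maxn N M)) => k; rewrite !gtn_max => /and3P[k1 /HN fk /HM gk].
apply: le_lt_trans (ler_normD _ _) (lt_le_trans (ltrD fk gk) _).
have k0 : (0 : R) < k%:R by rewrite ltr0n ltnW.
rewrite exprSr invfM -mulrDr -mulr2n -(mulr_natl _ 2) -[leRHS]mulr1.
by rewrite ler_pM2l ?invr_gt0 ?exprn_gt0 // ler_pdivrMr // mul1r ler_nat.
Qed.

Lemma negligible0 : negligible (fun=> 0 : R).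
Proof.
move=> c; exists 0%N => k k0.
by rewrite normr0 invr_gt0 exprn_gt0 // ltr0n.
Qed.

Lemma overwhelming_eq1 (p : nat -> R) : (forall k, p k = 1) -> overwhelming p.
Proof.
by move=> p1; apply: negligible_le _ negligible0 => k; rewrite p1 subrr lexx.
Qed.

Context {A : Type} {d : nat -> computation void A}.

Local Notation whp E := (overwhelming (fun k => Pr R (d k) E)).

Lemma overwhelming_mono (E F : pred A) :
  (forall x, E x -> F x) -> whp E -> whp F.
Proof.
move=> EF; apply: negligible_le => k.
by rewrite subr_ge0 Pr_le1 lerD2l lerN2 Pr_mono.
Qed.

Lemma overwhelming_predI (E F : pred A) : whp E -> whp F -> whp (predI E F).
Proof.
move=> EN FN; apply: negligible_le _ (negligible_add EN FN) => k.
rewrite subr_ge0 Pr_le1 /=; have := Pr_predI_ge (d k) E F; lra.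
Qed.

(** The index type does not vary with the security parameter, so the union bound is applied a fixed
    number of times. *)
Lemma overwhelming_forall (I : finType) (P : pred I) (E : I -> pred A) :
  (forall i, P i -> whp (E i)) ->
  whp (fun x => [forall (i | P i), E i x]).
Proof.
move=> EN.
suff: whp (fun x => all (fun i => P i ==> E i x) (enum I)).
  by apply: overwhelming_mono => x /allP H; apply/forallP => i; rewrite H ?mem_enum.
elim: (enum I) => [|i s IH] /=.
  by apply: overwhelming_eq1 => k; apply: Pr_predT.
apply: (overwhelming_predI (E := fun x => P i ==> E i x)) IH.
(* An index outside [P] contributes the sure event. *)
case: (boolP (P i)) => [/EN|_] //=.
by apply: overwhelming_eq1 => k; apply: Pr_predT.
Qed.

End Probability.

Section Shares.

Context {R : realType} {n l : nat} (Pi : protocol R n l) (T : {set 'I_n}).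

Lemma reward_ofC j E :
  reward_of Pi j [set: 'I_n] E = reward_of Pi j T E + reward_of Pi j (~: T) E.
Proof.
rewrite /reward_of [LHS](bigID (mem T)) /=.
by congr (_ + _); apply: eq_bigl => i; rewrite !inE.
Qed.

Lemma cost_share_setC E : cost_of Pi [set: 'I_n] E != 0 ->
  cost_of Pi (~: T) E / cost_of Pi [set: 'I_n] E =
  1 - cost_of Pi T E / cost_of Pi [set: 'I_n] E.
Proof.
move=> c0; rewrite -[X in X - _](divff c0) -mulrBl; congr (_ / _).
rewrite /cost_of [X in _ = X - _](bigID (mem T)) /=.
rewrite [X in _ = X + _ - _](eq_bigl (mem T)); last by move=> i; rewrite !inE.
by rewrite addrC addKr; apply: eq_bigl => i; rewrite !inE.
Qed.

Context {delta : R} {j : 'I_n} {E Ecost : @outcome n l}.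

(** Positivity of the total reward selects the quotient branch of [relative_rewards] and allows the
    fairness inequality to be divided by it. *)
Lemma fair_share_relative_ge : 0 < reward_of Pi j [set: 'I_n] E ->
  fair_share Pi delta j T E Ecost ->
  (1 - delta) * (cost_of Pi T Ecost / cost_of Pi [set: 'I_n] Ecost)
    <= relative_rewards Pi T j E.
Proof.
by move=> r0; rewrite /relative_rewards gt_eqF //= ler_pdivlMr.
Qed.

(** The rewards of [T] are what the complement leaves of the total, so a lower bound on the
    complement becomes an upper bound on [T]. *)
Lemma fair_share_setC_relative_le : 0 < reward_of Pi j [set: 'I_n] E ->
  cost_of Pi [set: 'I_n] Ecost != 0 ->
  fair_share Pi delta j (~: T) E Ecost ->
  relative_rewards Pi T j E <=
    1 - (1 - delta) *
      (1 - cost_of Pi T Ecost / cost_of Pi [set: 'I_n] Ecost).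
Proof.
move=> r0 c0; rewrite /fair_share cost_share_setC // => fairC.
rewrite /relative_rewards gt_eqF //= ler_pdivrMr //.
by move: fairC (reward_ofC j E); lra.
Qed.

End Shares.

Theorem theorem6 (R : realType) (n l : nat) (Pi : protocol R n l)
  (t : nat) (delta : R)
  (honest_adversary_PPT :
     forall T : {set 'I_n}, PPT (honest_adversary Pi T))
  (cost_neq0 :
     forall (Z : environment n) (T : {set 'I_n}) (kappa : nat),
       admissible Z ->
       Pr R (execution Pi Z T (honest_adversary Pi T) kappa)
         (fun E => cost_of Pi [set: 'I_n] E != 0) = 1)
  (delta_ge0 : 0 <= delta) (delta_lt1 : delta < 1)
  (fair : weak_fairness Pi t delta)
  (reward_gt0 :
     forall (Z : environment n) (T : {set 'I_n}) (A : adversary n l) (j : 'I_n),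
       admissible Z -> (#|T| <= t)%N -> PPT A -> j \notin T ->
       overwhelming (fun kappa =>
         Pr R (execution Pi Z T A kappa)
           (fun E' => 0 < reward_of Pi j [set: 'I_n] E'))) :
  EVP Pi t 0 delta (relative_rewards Pi).
Proof.
move=> Z T A j0 admZ leTt pptA j0T.
pose d kappa := independent (execution Pi Z T A kappa)
                  (execution Pi Z T (honest_adversary Pi T) kappa).
have Good j : j \notin T -> overwhelming (fun kappa =>
    Pr R (d kappa)
      (predI
        (fun x => fair_share Pi delta j (~: T) x.1 x.2 &&
           [forall SH : {set 'I_n}, fair_share Pi delta j SH x.2 x.2])
        (predI (fun x => 0 < reward_of Pi j [set: 'I_n] x.1)
               (fun x => 0 < reward_of Pi j [set: 'I_n] x.2)))).
  move=> jT; apply: overwhelming_predI.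
    by apply: overwhelming_mono _ (fair Z T A j admZ leTt pptA jT) => -[].
  apply: overwhelming_predI.
    apply: negligible_le _ (reward_gt0 Z T A j admZ leTt pptA jT) => k.
    by rewrite (Pr_independent_fst _ _ (fun E => 0 < reward_of Pi j _ E))
               subr_ge0 Pr_le1 /=.
  (* The honest execution is itself an execution with a PPT adversary, so the positivity hypothesis
     covers it too. *)
  apply: negligible_le _ (reward_gt0 Z T _ j admZ leTt (honest_adversary_PPT T) jT).
  move=> k; rewrite (Pr_independent_snd _ _ (fun E => 0 < reward_of Pi j _ E)).
  by rewrite subr_ge0 Pr_le1 /=.
have Cost : overwhelming (fun kappa =>
    Pr R (d kappa)
      (fun x => cost_of Pi [set: 'I_n] x.2 != 0)).
  apply: overwhelming_eq1 => k.
  by rewrite (Pr_independent_snd _ _ (fun E => cost_of Pi _ E != 0)) cost_neq0.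
(* The maximum and the minimum may be attained at different participants, so the good events of all
   honest ones must hold simultaneously. *)
apply: overwhelming_mono _
  (overwhelming_predI Cost (overwhelming_forall Good)) => -[E' E] /=.
move=> /andP[c0 /forall_inP good]; rewrite mul0r addr0.
(* Both parts of fairness measure costs in the same sample [E] of the honest execution, so one
   random share [s] enters both bounds. *)
set s := cost_of Pi T E / cost_of Pi [set: 'I_n] E.
have upper j : j \notin T ->
    relative_rewards Pi T j E' <= 1 - (1 - delta) * (1 - s).
  move=> /good /= /and3P[/andP[f _] r _].
  exact: fair_share_setC_relative_le.
have lower j : j \notin T -> (1 - delta) * s <= relative_rewards Pi T j E.
  move=> /good /= /and3P[/andP[_ /forallP f] _ r].
  exact: fair_share_relative_ge.
have le_max : Umax (relative_rewards Pi) T j0 E' <= 1 - (1 - delta) * (1 - s).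
  (* The default value of the maximum is the utility seen by [j0], which is honest, so [upper]
     bounds it as well. *)
  by apply: bigmax_le => [|j]; apply: upper.
have ge_min : (1 - delta) * s <= Umin (relative_rewards Pi) T j0 E.
  by apply: le_bigmin => [|j]; apply: lower.
by lra.
Qed.
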